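(* Let $\phi$ be a dgf on $\mathbb R^n$, $X=\operatorname{dom}\phi$, $Y=\operatorname{int}\operatorname{dom}\phi$. For any $\lambda>0$, $f:X\to\overline{\mathbb R}$ and $g:Y\to\overline{\mathbb R}$ the following hold: (i) If $\operatorname{range}\overleftarrow{\mathrm{prox}}_{\lambda f}\subseteq\operatorname{int}\operatorname{dom}\phi$, then $\overleftarrow{\mathrm{prox}}_{\lambda f}=(\nabla\phi+\lambda\overleftarrow{\partial}_\lambda f)^{-1}\circ\nabla\phi$. (ii) If $X=\mathbb R^n$, then $\overrightarrow{\mathrm{prox}}_{\lambda g}=(\mathrm{id}+\lambda\overrightarrow{\partial}_\lambda g)^{-1}$.
   Context: $\overline{\mathbb R}=[-\infty,\infty]$. A distance-generating function (dgf) is a proper, lsc, convex $\phi:\mathbb R^n\to\overline{\mathbb R}$ that is differentiable on $\operatorname{int}\operatorname{dom}\phi\neq\emptyset$. $D_\phi(x,y)=\phi(x)-\phi(y)-\langle\nabla\phi(y),x-y\rangle$ if $y\in Y$, and $\infty$ otherwise. For $\bar y\in Y$ and $\bar x\in X$ ($\operatorname{argmin}$ denotes the set of points attaining the infimum): $\overleftarrow{\mathrm{prox}}_{\lambda f}(\bar y)=\operatorname{argmin}_{x\in X}\{f(x)+\frac1\lambda D_\phi(x,\bar y)\}$ and $\overrightarrow{\mathrm{prox}}_{\lambda g}(\bar x)=\operatorname{argmin}_{y\in Y}\{g(y)+\frac1\lambda D_\phi(\bar x,y)\}$. Left Bregman level proximal subdifferential $\overleftarrow{\partial}_\lambda f:X\rightrightarrows\mathbb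 R^n$: $\bar u\in\overleftarrow{\partial}_\lambda f(\bar x)$ iff $\bar x\in\operatorname{int}X$ and $f(x)\ge f(\bar x)+\langle\bar u,x-\bar x\rangle-\frac1\lambda D_\phi(x,\bar x)$ for all $x\in X$. Right Bregman level proximal subdifferential $\overrightarrow{\partial}_\lambda g:Y\rightrightarrows\mathbb R^n$: $\bar v\in\overrightarrow{\partial}_\lambda g(\bar y)$ iff $g(y)\ge g(\bar y)+\langle\bar v,\nabla\phi(y)-\nabla\phi(\bar y)\rangle-\frac1\lambda D_\phi(\bar y,y)$ for all $y\in Y$. For a set-valued operator $T$, $T^{-1}(y)=\{x:y\in T(x)\}$ and $\operatorname{range}T=\bigcup_xT(x)$. $\nabla\phi$ is defined on $Y=\operatorname{int}X$ only. *)

(* Defs.v *)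
From HB Require Import structures.
From mathcomp Require Import all_boot all_order all_algebra.
From mathcomp Require Import all_classical all_reals all_analysis.

Set Implicit Arguments.
Unset Strict Implicit.
Unset Printing Implicit Defensive.

Import Order.TTheory GRing.Theory Num.Theory.
Import numFieldNormedType.Exports.

Local Open Scope classical_set_scope.
Local Open Scope ring_scope.
Local Open Scope ereal_scope.

(* A set-valued operator T : A ⇉ B with A a subset of S is a function
   S -> set T whose values off A are empty. *)
Section SetValuedOperators.

Definition sv_fun {S T : Type} (A : set S) (h : S -> T) : S -> set T :=
  fun x => [set y | A x /\ y = h x].

Definition sv_id {S : Type} : S -> set S := fun x => [set x].

Definition sv_inv {S T : Type} (F : S -> set T) : T -> set S :=
  fun y => [set x | F x y].

Definition sv_comp {S T U : Type} (G : T -> set U) (F : S -> set T) :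
    S -> set U :=
  fun x => \bigcup_(y in F x) G y.

Definition sv_range {S T : Type} (F : S -> set T) : set T :=
  \bigcup_(x in [set: S]) F x.

Definition sv_add {S : Type} {V : zmodType} (F G : S -> set V) : S -> set V :=
  fun x => [set (a + b)%R | a in F x & b in G x].

Definition sv_scale {S : Type} {R : pzRingType} {V : lmodType R}
    (c : R) (F : S -> set V) : S -> set V :=
  fun x => [set (c *: a)%R | a in F x].

End SetValuedOperators.

Definition argmin {T : Type} {R : realType} (A : set T) (h : T -> \bar R) :
    set T :=
  [set x | A x /\ h x = ereal_inf [set h z | z in A]].

Section Bregman.
Context {R : realType} {n : nat}.
Implicit Types (phi f g : 'rV[R]_n -> \bar R) (x y u v : 'rV[R]_n).

Definition dotp u v : R := (\sum_(i < n) u ord0 i * v ord0 i)%R.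

Definition edom phi : set 'rV[R]_n := [set x | phi x < +oo].

Definition intdom phi : set 'rV[R]_n := (edom phi)°.

Definition proper_fun phi : Prop :=
  (forall x, -oo < phi x) /\ edom phi !=set0.

(* The right-hand side is never of the form +oo - oo when [phi] is proper. *)
Definition ereal_convex phi : Prop :=
  forall x y (t : R), (0 < t < 1)%R ->
    phi (t *: x + (1 - t) *: y)%R <= t%:E * phi x + (1 - t)%:E * phi y.

(* [phi] is finite on the interior of its domain, so there
   [fine \o phi] is [phi] seen as a real-valued function. *)
Definition is_dgf phi : Prop :=
  [/\ proper_fun phi,
      lower_semicontinuous phi,
      ereal_convex phi,
      intdom phi !=set0
    & forall x, intdom phi x -> differentiable (fine \o phi : _ -> R^o) x].

Definition grad phi y : 'rV[R]_n :=
  (\row_(i < n) 'D_(delta_mx ord0 i) (fine \o phi : _ -> R^o) y)%R.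

Definition bregman phi x y : \bar R :=
  if y \in intdom phi then phi x - phi y - (dotp (grad phi y) (x - y)%R)%:E
  else +oo.

(* Functions on X = edom phi (resp. Y = intdom phi) are represented by
   functions on the whole space whose values off X (resp. Y) are never used. *)

Definition left_prox phi (lambda : R) f : 'rV[R]_n -> set 'rV[R]_n :=
  fun yb => [set xb | intdom phi yb /\
    argmin (edom phi) (fun x => f x + lambda^-1%:E * bregman phi x yb) xb].

Definition right_prox phi (lambda : R) g : 'rV[R]_n -> set 'rV[R]_n :=
  fun xb => [set yb | edom phi xb /\
    argmin (intdom phi) (fun y => g y + lambda^-1%:E * bregman phi xb y) yb].

Definition left_subdiff phi (lambda : R) f : 'rV[R]_n -> set 'rV[R]_n :=
  fun xb => [set ub | intdom phi xb /\
    forall x, edom phi x ->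
      f xb + (dotp ub (x - xb)%R)%:E - lambda^-1%:E * bregman phi x xb <= f x].

Definition right_subdiff phi (lambda : R) g : 'rV[R]_n -> set 'rV[R]_n :=
  fun yb => [set vb | intdom phi yb /\
    forall y, intdom phi y ->
      g yb + (dotp vb (grad phi y - grad phi yb)%R)%:E
        - lambda^-1%:E * bregman phi yb y <= g y].

Definition sv_grad phi : 'rV[R]_n -> set 'rV[R]_n :=
  sv_fun (intdom phi) (grad phi).

End Bregman.

(* Main.v *)
Require Import Defs.
From HB Require Import structures.
From mathcomp Require Import all_boot all_order all_algebra.
From mathcomp Require Import all_classical all_reals all_analysis.
From mathcomp Require Import ring.
Import Order.TTheory GRing.Theory Num.Theory.
Local Open Scope classical_set_scope.
Local Open Scope ring_scope.

(** Both proximal operators and both subdifferentials are the same family of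
    inequalities, rearranged by a three-point identity.

    On the left, for a base point [y] in the interior of the domain, [x]
    minimises [f + D(., y) / lambda] iff
    [f x + (D(x, y) - D(z, y)) / lambda <= f z] for every [z] in the domain.
    When [x] is also an interior point,
    [D(x, y) - D(z, y) = <grad y - grad x, z - x> - D(z, x)],
    so this says exactly that [(grad y - grad x) / lambda] is a left
    subgradient of [f] at [x] ([left_prox_subdiff]); solving for [grad y] gives
    the resolvent formula.

    On the right, the companion identity
    [D(x, y) - D(x, z) = <x - y, grad z - grad y> - D(y, z)] turns minimality
    of [y] into the statement that [(x - y) / lambda] is a right subgradient of
    [g] at [y] ([right_prox_subdiff]).

    The identities are purely algebraic; they may be used inside the
    inequalities because [D] is real at all the points compared, so that the
    rearrangement stays legitimate where [f] or [g] is infinite.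

    In each formula the remaining hypothesis reconciles the domains of the two
    sides: a left subgradient exists only at interior points, so proximal points
    must be interior; and the right resolvent could be nonempty at a point off
    the domain of [phi], where the right proximal operator is empty. *)

Lemma argmin_lb {T : Type} {R : realType} (A : set T) (h : T -> \bar R) x :
  argmin A h x <-> A x /\ forall z, A z -> (h x <= h z)%E.
Proof.
split=> -[Ax hx]; split=> //.
  by move=> z Az; rewrite hx; apply: ereal_inf_lbound; exists z.
apply/eqP; rewrite eq_le; apply/andP; split.
  by apply: le_ereal_inf_tmp => _ [z Az <-]; exact: hx.
by apply: ereal_inf_lbound; exists x.
Qed.

(** Only real quantities are moved across the inequality, so no
    indeterminate sum arises even when [a] or [b] is infinite. *)
Lemma lee_shift {R : realType} (a b : \bar R) (r s t : R) : r - s = t ->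
  (a + r%:E <= b + s%:E)%E = (a + t%:E <= b)%E.
Proof. by move=> <-; rewrite EFinB addeA leeBlDr. Qed.

Section InnerProduct.
Context {R : realType} {n : nat}.
Implicit Types u v w : 'rV[R]_n.

Lemma dotpC u v : dotp u v = dotp v u.
Proof. by apply: eq_bigr => i _; rewrite mulrC. Qed.

Lemma dotpBl u v w : dotp (u - v) w = dotp u w - dotp v w.
Proof. by rewrite /dotp -sumrB; apply: eq_bigr => i _; rewrite !mxE mulrBl. Qed.

Lemma dotpBr u v w : dotp w (u - v) = dotp w u - dotp w v.
Proof. by rewrite dotpC dotpBl !(dotpC w). Qed.

Lemma dotpZl (c : R) u v : dotp (c *: u) v = c * dotp u v.
Proof.
by rewrite /dotp mulr_sumr; apply: eq_bigr => i _; rewrite mxE mulrA.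
Qed.

End InnerProduct.

Section Bregman.
Context {R : realType} {n : nat}.
Context (phi : 'rV[R]_n -> \bar R).
Implicit Types (f g : 'rV[R]_n -> \bar R) (x y z u v : 'rV[R]_n).

Definition bregman_real x y : R :=
  fine (phi x) - fine (phi y) - dotp (grad phi y) (x - y).

Lemma bregman_three_point_left x y z :
  bregman_real x y - bregman_real z y =
  dotp (grad phi y - grad phi x) (z - x) - bregman_real z x.
Proof. by rewrite /bregman_real dotpBl !dotpBr; ring. Qed.

Lemma bregman_three_point_right x y z :
  bregman_real x y - bregman_real x z =
  dotp (x - y) (grad phi z - grad phi y) - bregman_real y z.
Proof.
rewrite /bregman_real !dotpBr !dotpBl !(dotpC x) !(dotpC y); ring.
Qed.

Context (phi_proper : proper_fun phi).

Lemma edom_fineK x : edom phi x -> (fine (phi x))%:E = phi x.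
Proof.
have [phi_gt _] := phi_proper => phix.
by rewrite fineK// fin_numElt phi_gt.
Qed.

Lemma intdom_edom x : intdom phi x -> edom phi x.
Proof. exact: interior_subset. Qed.

Lemma bregmanE x y : edom phi x -> intdom phi y ->
  bregman phi x y = (bregman_real x y)%:E.
Proof.
move=> Xx Yy; rewrite /bregman mem_set// -(edom_fineK _ Xx).
by rewrite -(edom_fineK _ (intdom_edom _ Yy)).
Qed.

Context (lambda : R).

(** Pointwise in the competitor [z], the minimality inequality and the
    subgradient inequality are one and the same once [D(z, y)] is moved to the
    left.  Interiority of [x] is what lets [grad phi x] recentre [D] at [x]. *)
Lemma left_prox_subdiff f x y : intdom phi x -> intdom phi y ->
  left_prox phi lambda f y x <->
  left_subdiff phi lambda f x (lambda^-1 *: (grad phi y - grad phi x)).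
Proof.
move=> Yx Yy; have Xx := intdom_edom _ Yx.
have ineqE z : edom phi z ->
    (f x + lambda^-1%:E * bregman phi x y <=
     f z + lambda^-1%:E * bregman phi z y)%E =
    (f x + (dotp (lambda^-1 *: (grad phi y - grad phi x)) (z - x))%:E
       - lambda^-1%:E * bregman phi z x <= f z)%E.
  move=> Xz; rewrite !bregmanE// -!EFinM -addeA -EFinB.
  by apply: lee_shift; rewrite -mulrBr bregman_three_point_left dotpZl mulrBr.
split.
  move=> [_ /argmin_lb[_ xmin]]; split=> // z Xz.
  by rewrite -ineqE//; exact: xmin.
move=> [_ xsub]; split=> //; apply/argmin_lb; split=> // z Xz.
by rewrite ineqE//; exact: xsub.
Qed.

(** Here the competitor [z] enters [D] through its gradient, so [D(y, z)] has
    its first argument at the minimiser; [x] may lie on the boundary of the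
    domain, since [D] is never centred there. *)
Lemma right_prox_subdiff g x y : edom phi x -> intdom phi y ->
  right_prox phi lambda g x y <->
  right_subdiff phi lambda g y (lambda^-1 *: (x - y)).
Proof.
move=> Xx Yy; have Xy := intdom_edom _ Yy.
have ineqE z : intdom phi z ->
    (g y + lambda^-1%:E * bregman phi x y <=
     g z + lambda^-1%:E * bregman phi x z)%E =
    (g y + (dotp (lambda^-1 *: (x - y)) (grad phi z - grad phi y))%:E
       - lambda^-1%:E * bregman phi y z <= g z)%E.
  move=> Yz; rewrite !bregmanE// -!EFinM -addeA -EFinB.
  by apply: lee_shift; rewrite -mulrBr bregman_three_point_right dotpZl mulrBr.
split.
  move=> [_ /argmin_lb[_ ymin]]; split=> // z Yz.
  by rewrite -ineqE//; exact: ymin.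
move=> [_ ysub]; split=> //; apply/argmin_lb; split=> // z Yz.
by rewrite ineqE//; exact: ysub.
Qed.

End Bregman.

(** With [U] the values of a subdifferential at a point, and [a] either that
    point or the gradient of the kernel there, this reads off membership in the
    graph of a resolvent. *)
Lemma add_scale_solve {R : realType} {n : nat} (lambda : R)
    (U : set 'rV[R]_n) (a w : 'rV[R]_n) : lambda != 0 ->
  (exists2 b, [set lambda *: u | u in U] b & a + b = w) <->
  U (lambda^-1 *: (w - a)).
Proof.
move=> l0; split=> [[_ [u Uu <-] <-]|Uu].
  by rewrite [a + _]addrC addrK scalerA mulVf// scale1r.
exists (w - a); last by rewrite addrC subrK.
by exists (lambda^-1 *: (w - a)) => //; rewrite scalerA mulfV// scale1r.
Qed.

Theorem corollary3p6 (R : realType) (n : nat) (phi : 'rV[R]_n -> \bar R)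
    (hphi : is_dgf phi) (lambda : R) (hlambda : 0 < lambda)
    (f g : 'rV[R]_n -> \bar R) :
  (sv_range (left_prox phi lambda f) `<=` intdom phi ->
     left_prox phi lambda f =
     sv_comp
       (sv_inv (sv_add (sv_grad phi) (sv_scale lambda (left_subdiff phi lambda f))))
       (sv_grad phi))
  /\
  (edom phi = [set: 'rV[R]_n] ->
     right_prox phi lambda g =
     sv_inv (sv_add sv_id (sv_scale lambda (right_subdiff phi lambda g)))).
Proof.
have [phi_proper _ _ _ _] := hphi.
have l0 : lambda != 0 by rewrite gt_eqF.
split=> [range_int|X_full]; apply/funext => p; apply/seteqP; split=> q.
- move=> prox_q; have Yp : intdom phi p by case: prox_q.
  have Yq : intdom phi q by apply: range_int; exists p.
  exists (grad phi p) => //; exists (grad phi q) => //.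
  by apply/add_scale_solve => //; apply/left_prox_subdiff.
- move=> [_ [Yp ->] [_ [Yq ->] /(add_scale_solve _ _ _ _ l0) sub_q]].
  exact/left_prox_subdiff.
- move=> prox_q; have [Xp [Yq _]] := prox_q.
  by exists q => //; apply/add_scale_solve => //; apply/right_prox_subdiff.
- move=> [_ -> /(add_scale_solve _ _ _ _ l0) sub_q].
  have Yq : intdom phi q by case: sub_q.
  by apply/right_prox_subdiff => //; rewrite X_full.
Qed.
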